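(* Let $\alpha\in\mathbb{N}_0$ and $\lambda,\eta,\delta\in\mathbb{C}$ be such that $(\alpha,\lambda,\delta)$ is admissible (as defined in the context), and let $n\in\mathbb{N}$. Then for all $x_1,x_2$, $${}_{\mathfrak{B}}\mathcal{F}_n^{(\alpha)}(x_1,x_2;\lambda;\eta,\delta)=\sum_{j=0}^{n}\sum_{k\ge 0}\binom{n}{j}(x_1)_k\,\mathcal{S}_2(j,k)\;{}_{\mathfrak{B}}\mathcal{F}_{n-j}^{(\alpha)}(x_2;\lambda;\eta,\delta).$$
   Context: $\mathbb{N}=\{1,2,3,\dots\}$, $\mathbb{N}_0=\{0,1,2,\dots\}$; $x_1,x_2$ are complex variables. Here $2^\eta=e^{\eta\ln 2}$ and $\left(\frac{2^{\eta}t^{\delta}}{\lambda e^{t}+1}\right)^{\alpha}$ means $2^{\eta\alpha}t^{\delta\alpha}(\lambda e^t+1)^{-\alpha}$. The triple $(\alpha,\lambda,\delta)$ is called admissible if this factor has a power series expansion at $t=0$, i.e. $\alpha\delta$ is an integer with $\alpha\delta\ge 0$ if $\lambda\neq -1$, and $\alpha\delta\ge\alpha$ if $\lambda=-1$. For admissible parameters, all generating functions are power series expansions at $t=0$. The Bell based Apostol type polynomials of order $\alpha$ are defined by $$\sum_{n\ge 0}{}_{\mathfrak{B}}\mathcal{F}_n^{(\alpha)}(x_1,x_2;\lambda;\eta,\delta)\frac{t^n}{n!}=\left(\frac{2^{\eta}t^{\delta}}{\lambda e^{t}+1}\right)^{\alpha}e^{x_1t+x_2(e^t-1)}.$$ The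 one-variable notation means ${}_{\mathfrak{B}}\mathcal{F}_n^{(\alpha)}(x_2;\lambda;\eta,\delta):={}_{\mathfrak{B}}\mathcal{F}_n^{(\alpha)}(0,x_2;\lambda;\eta,\delta)$. The symbol $(x)_k=x(x-1)\cdots(x-k+1)$, $(x)_0=1$, is the falling factorial. The Stirling numbers of the second kind $\mathcal{S}_2(j,k)$ are defined by $\sum_{j\ge 0}\mathcal{S}_2(j,k)\frac{t^j}{j!}=\frac{(e^t-1)^k}{k!}$; since $\mathcal{S}_2(j,k)=0$ for $k>j$, the sum over $k$ is finite. *)

(* Defs.v *)
(* MathComp-Analysis *)
From HB Require Import structures.
From mathcomp Require Import all_boot all_order all_algebra.
From mathcomp Require Import complex.
From mathcomp Require Import all_classical all_reals all_analysis.

Set Implicit Arguments.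
Unset Strict Implicit.
Unset Printing Implicit Defensive.

Import Order.TTheory GRing.Theory Num.Theory.
Import numFieldNormedType.Exports.

Local Open Scope classical_set_scope.
Local Open Scope ring_scope.
Local Open Scope complex_scope.

(* The neighbourhood is punctured because the formula giving [f] may be
   singular at 0 (a removable singularity): for instance t / (1 - e^t). *)
Definition has_egf (C : numFieldType) (f : C -> C) (a : nat -> C) : Prop :=
  \forall t \near (0 : C)^',
    series (fun n => a n * (t ^+ n / n`!%:R)) @ \oo --> f t.

(* [egf_coef f n] is n! times the coefficient of t^n in the power series
   expansion of [f] at 0; it is 0 if [f] has no such expansion. *)
Definition egf_coef (C : numFieldType) (f : C -> C) : nat -> C :=
  xget (fun=> 0) [set a | has_egf f a].

Definition falling (C : numFieldType) (x : C) (k : nat) : C :=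
  \prod_(i < k) (x - i%:R).

(* [z ^ w] for an exponent [w] in [C] which is an integer, the only case in
   which it is meaningful here. *)
Definition intpow (C : numFieldType) (z w : C) : C :=
  z ^ (xget 0 [set m : int | m%:~R = w]).

Definition cexp (R : realType) (z : R[i]) : R[i] :=
  let: a +i* b := z in (expR a * cos b) +i* (expR a * sin b).

Definition two_pow (R : realType) (w : R[i]) : R[i] := cexp (w * (ln 2)%:C).

Definition admissible (R : realType) (alpha : nat) (lambda delta : R[i]) : Prop :=
  exists m : int, [/\ alpha%:R * delta = m%:~R,
    lambda != -1 -> 0 <= m & lambda = -1 -> alpha%:Z <= m].

Definition apostol_factor (R : realType) (alpha : nat)
    (lambda eta delta t : R[i]) : R[i] :=
  two_pow (eta * alpha%:R) * intpow t (delta * alpha%:R)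
    * (lambda * cexp t + 1) ^- alpha.

Definition bell_apostol (R : realType) (alpha : nat)
    (x1 x2 lambda eta delta : R[i]) (n : nat) : R[i] :=
  egf_coef (fun t : R[i] => apostol_factor alpha lambda eta delta t
                            * cexp (x1 * t + x2 * (cexp t - 1))) n.

Definition bell_apostol1 (R : realType) (alpha : nat)
    (x2 lambda eta delta : R[i]) (n : nat) : R[i] :=
  bell_apostol alpha 0 x2 lambda eta delta n.

Definition stirling2 (R : realType) (j k : nat) : R[i] :=
  egf_coef (fun t : R[i] => (cexp t - 1) ^+ k / k`!%:R) j.

(* Main.v *)
Require Import Defs.
From mathcomp Require Import all_boot all_order all_algebra.
From mathcomp Require Import complex.
From mathcomp Require Import all_classical all_reals all_analysis.
From mathcomp Require Import ring.

Import Order.TTheory GRing.Theory Num.Theory.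
Import numFieldNormedType.Exports.

Local Open Scope classical_set_scope.
Local Open Scope ring_scope.
Local Open Scope complex_scope.

(** Write [g] for the generating function at [x1 = 0]. The generating function
    at [x1] is [e^(x1 t) * g], and [e^(x1 t)] has exponential coefficients
    [x1 ^+ j], so the Cauchy product gives the binomial convolution
    [\sum_j 'C(n, j) * x1 ^+ j * b (n - j)], where [b] is the coefficient
    sequence of [g]. It remains to expand [x1 ^+ j] in falling factorials, with
    the Stirling numbers as coefficients ([sum_falling_stirling]).

    Coefficients are read off a function, so two facts carry the proof:
    an expansion near 0 is unique ([has_egf_unique]), and the product of two
    functions with an expansion has the convolution as expansion ([has_egfM]).
    No expansion of [g] has to be exhibited: since [g] is in turn
    [e^(- x1 t)] times the generating function at [x1], either both have an
    expansion, or neither has one and both sides of the identity are 0.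

    The remaining analytic input is that [cexp] is the sum of its power series
    ([cvg_cexp_series]), obtained from the real series of [expR], [cos] and
    [sin] by a Cauchy product. It yields the expansion of [(e^t - 1)^k / k!]
    by the binomial theorem, hence the explicit alternating sum for the
    Stirling numbers ([stirling2E]), and from it their recurrence. *)

(** * Uniqueness of expansions *)

(** The terms of an expansion decay as fast as any prescribed geometric
    sequence, at every [t] close enough to 0: they are bounded at one nonzero
    point of convergence [t0], and [`|t| <= q * `|t0|] suffices. *)
Lemma has_egf_terms_le (C : numFieldType) (f : C -> C) (a : nat -> C) (q : C) :
  0 < q -> has_egf f a ->
  exists2 M : C, 0 <= M &
    \forall t \near (0 : C)^', forall n,
      `|a n * (t ^+ n / n`!%:R)| <= M * q ^+ n.
Proof.
move=> q0 fa.
have [t0 [t0N0 cvgt0]] : exists t0 : C, t0 != 0 /\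
    series (fun n => a n * (t0 ^+ n / n`!%:R)) @ \oo --> f t0.
  have /filter_ex[t [tN0 tf]] : \forall t \near (0 : C)^', t != 0 /\
    series (fun n => a n * (t ^+ n / n`!%:R)) @ \oo --> f t.
    near=> t; split; last by near: t.
    by near: t; exact: nbhs_dnbhs_neq.
  by exists t.
have {}cvgt0 : cvgn (series (fun n => a n * (t0 ^+ n / n`!%:R))).
  by apply/cvg_ex; exists (f t0).
have c0 := @cvg_series_cvg_0 C C^o _ cvgt0.
have : bounded_fun (fun n => a n * (t0 ^+ n / n`!%:R) : C^o).
  by apply: cvg_seq_bounded; apply/cvg_ex; exists 0.
move=> /(@ex_bound _ _ _ _ _ (@globally_properfilter _ setT 0%N I))[M HM].
have {}HM n : `|a n * (t0 ^+ n / n`!%:R)| <= M by apply: HM.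
exists M; first exact: le_trans (HM 0%N).
have qt0 : 0 < q * `|t0| by rewrite mulr_gt0// normr_gt0.
near=> t => n.
have -> : a n * (t ^+ n / n`!%:R) = a n * (t0 ^+ n / n`!%:R) * (t / t0) ^+ n.
  by rewrite expr_div_n; field; rewrite ?expf_neq0// ?pnatr_eq0 -?lt0n ?fact_gt0.
rewrite normrM normrX ler_pM// lerXn2r ?nnegrE// ?(ltW q0)//.
rewrite normrM normfV ler_pdivrMr ?normr_gt0//.
by near: t; apply: dnbhs0_le.
Unshelve. all: by end_near. Qed.

Lemma sum_half_expr_le (C : numFieldType) (n : nat) :
  \sum_(i < n) (2^-1 : C) ^+ i <= 2.
Proof.
elim: n => [|n IHn]; first by rewrite big_ord0.
rewrite big_ord_recl expr0.
under eq_bigr do rewrite exprS.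
rewrite -mulr_sumr.
rewrite [leRHS](_ : 2 = 1 + 2^-1 * 2); last by rewrite mulVf ?pnatr_eq0.
by rewrite lerD2l ler_pM2l// invr_gt0.
Qed.

(** Identity theorem for power series. At the first nonzero coefficient [c n],
    the tail beyond [n] has norm at most [K * `|t| ^+ n.+1], hence at most half
    the norm of [c n * t ^+ n] for small [t], so the partial sums cannot tend
    to 0. *)
Lemma power_series_eq0 (C : numFieldType) (c : nat -> C) (M : C) :
  (exists2 t0 : C, t0 != 0 & forall n, `|c n * t0 ^+ n| <= M) ->
  (\forall t \near (0 : C)^', series (fun n => c n * t ^+ n) @ \oo --> (0 : C)) ->
  forall n, c n = 0.
Proof.
move=> [r r0 cM] c0; apply: ltn_ind => n IHn.
apply/eqP/negPn/negP => cn0.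
have M0 : 0 <= M by apply: le_trans (cM 0%N).
pose K := M / `|r| ^+ n.+1 * 2.
have K0 : 0 <= K by rewrite mulr_ge0// divr_ge0// exprn_ge0.
have [t [tN0 tr tK tc]] : exists t : C, [/\ t != 0, `|t| <= `|r| / 2,
    `|t| * K < `|c n| / 2 &
    series (fun n => c n * t ^+ n) @ \oo --> (0 : C)].
  apply: (@filter_ex _ (0 : C)^' _); near=> t; split.
  - by near: t; exact: nbhs_dnbhs_neq.
  - by near: t; apply: dnbhs0_le; rewrite divr_gt0// normr_gt0.
  - apply: (@le_lt_trans _ _ (`|t| * (K + 1))).
      by rewrite ler_wpM2l// lerDl.
    rewrite -ltr_pdivlMr ?ltr_wpDl//.
    by near: t; apply: dnbhs0_lt; rewrite !divr_gt0 ?normr_gt0// ltr_wpDl.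
  - by near: t.
have e0 : 0 < `|t| ^+ n * (`|c n| / 2).
  by rewrite mulr_gt0 ?exprn_gt0 ?divr_gt0 ?normr_gt0.
have /cvgr0_norm_lt/(_ _ e0)[N _ HN] := tc.
have := HN (n.+1 + N)%N (leq_trans (leq_addl _ _) (leqnn _)).
rewrite /series/= big_mkord big_split_ord/= big_ord_recr/= big1 ?add0r; last first.
  by move=> i _; rewrite IHn ?mul0r.
set S := (X in `|_ + X| < _); apply/negP.
have Sle : `|S| <= `|t| ^+ n * (`|t| * K).
  rewrite /S (eq_bigr (fun i : 'I_N =>
    t ^+ n.+1 * (c (n.+1 + i)%N * t ^+ i))); last first.
    by move=> i _; rewrite exprD mulrCA.
  rewrite -mulr_sumr normrM normrX exprSr -mulrA ler_wpM2l ?exprn_ge0//.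
  rewrite ler_wpM2l// (le_trans (ler_norm_sum _ _ _))//.
  apply: (@le_trans _ _ (\sum_(i < N) M / `|r| ^+ n.+1 * 2^-1 ^+ i)).
    apply: ler_sum => i _.
    have -> : c (n.+1 + i)%N * t ^+ i =
        c (n.+1 + i)%N * r ^+ (n.+1 + i) / r ^+ n.+1 * (t / r) ^+ i.
      by rewrite expr_div_n exprD; field; rewrite !expf_neq0.
    rewrite normrM normrX normf_div normrX.
    rewrite ler_pM ?divr_ge0 ?exprn_ge0//.
      by rewrite ler_wpM2r ?invr_ge0 ?exprn_ge0.
    rewrite lerXn2r ?nnegrE ?invr_ge0// normf_div ler_pdivrMr ?normr_gt0//.
    by rewrite mulrC.
  by rewrite -mulr_sumr ler_wpM2l ?sum_half_expr_le// divr_ge0// exprn_ge0.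
rewrite -real_leNgt ?realE ?normr_ge0 ?(ltW e0)//.
apply: le_trans (lerB_normD _ _).
rewrite lerBrDr normrM normrX.
have -> : `|c n| * `|t| ^+ n = `|t| ^+ n * (`|c n| / 2) + `|t| ^+ n * (`|c n| / 2).
  by field.
by rewrite lerD2l (le_trans Sle)// ler_wpM2l ?exprn_ge0// ltW.
Unshelve. all: by end_near. Qed.

Lemma has_egf_unique (C : numFieldType) (f : C -> C) (a b : nat -> C) :
  has_egf f a -> has_egf f b -> a = b.
Proof.
move=> fa fb.
(* With ratio 1 the estimate is plain boundedness of the terms. *)
have [M _ Ma] := @has_egf_terms_le _ _ _ 1 ltr01 fa.
have [M' _ Mb] := @has_egf_terms_le _ _ _ 1 ltr01 fb.
suff c0 n : (a n - b n) / n`!%:R = 0.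
  apply/funext => n; have /eqP := c0 n.
  by rewrite mulf_eq0 invr_eq0 pnatr_eq0 -leqn0 leqNgt fact_gt0 orbF subr_eq0 => /eqP.
apply: (@power_series_eq0 _ (fun n => (a n - b n) / n`!%:R) (M + M')).
  suff /filter_ex[t [t0 tM]] : \forall t \near (0 : C)^', t != 0 /\ forall n,
    `|(a n - b n) / n`!%:R * t ^+ n| <= M + M' by exists t.
  near=> t; split; first by near: t; exact: nbhs_dnbhs_neq.
  have Mat : forall k, `|a k * (t ^+ k / k`!%:R)| <= M * 1 ^+ k by near: t.
  have Mbt : forall k, `|b k * (t ^+ k / k`!%:R)| <= M' * 1 ^+ k by near: t.
  move=> k; rewrite mulrAC -mulrA mulrBl (le_trans (ler_normB _ _))// lerD//.
    by have := Mat k; rewrite expr1n mulr1.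
  by have := Mbt k; rewrite expr1n mulr1.
near=> t.
have cta : series (fun n => a n * (t ^+ n / n`!%:R)) @ \oo --> f t by near: t.
have ctb : series (fun n => b n * (t ^+ n / n`!%:R)) @ \oo --> f t by near: t.
rewrite (_ : series _ = series (fun n => a n * (t ^+ n / n`!%:R)) -
    series (fun n => b n * (t ^+ n / n`!%:R))).
  by rewrite -(subrr (f t)); exact: cvgB cta ctb.
apply/funext => N; rewrite fctE /series/= -sumrB; apply: eq_bigr => i _.
by rewrite -mulrBl mulrAC -mulrA.
Unshelve. all: by end_near. Qed.

Lemma egf_coefE (C : numFieldType) (f : C -> C) (a : nat -> C) :
  has_egf f a -> egf_coef f = a.
Proof.
by move=> fa; apply: xget_unique => // b fb; exact: has_egf_unique fb fa.
Qed.

Lemma egf_coef_eq0 (C : numFieldType) (f : C -> C) :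
  (forall a, ~ has_egf f a) -> egf_coef f = fun=> 0.
Proof. by move=> nf; rewrite /egf_coef; case: xgetP => // a _ /nf. Qed.

(** * Cauchy products *)

(** The powers of 1/2 tend to 0 in every archimedean field. Here and below this
    is a hypothesis, so that the order on [C] may be partial, as on [R[i]]. *)
Lemma cvg0_geometric (C : numFieldType) (u : nat -> C) (M : C) :
  (fun n => 2^-1 ^+ n : C) @ \oo --> (0 : C) ->
  (forall n, `|u n| <= M * 2^-1 ^+ n) -> u @ \oo --> (0 : C).
Proof.
move=> half0 uM; apply/cvgr0Pnorm_lt => e e0.
have M0 : 0 <= M.
  by have := uM 0%N; rewrite expr0 mulr1; apply: le_trans.
have M1 : 0 < M + 1 by rewrite ltr_wpDl.
have /cvgr0Pnorm_lt/(_ (e / (M + 1))) := half0.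
move=> /(_ (divr_gt0 e0 M1)); apply: filterS => n.
rewrite ger0_norm ?exprn_ge0 ?invr_ge0// ltr_pdivlMr// mulrC; apply: le_lt_trans.
by rewrite (le_trans (uM n))// ler_wpM2r ?exprn_ge0 ?invr_ge0// lerDl.
Qed.

Lemma series_convE (A : pzRingType) (u v : nat -> A) (N : nat) :
  series (fun n => \sum_(0 <= j < n.+1) u j * v (n - j)%N) N =
  \sum_(0 <= i < N) u i * \sum_(0 <= j < N - i) v j.
Proof.
rewrite /series/=; elim: N => [|N IHN]; first by rewrite !big_nil.
rewrite big_nat_recr//= IHN [RHS]big_nat_recr//= [X in _ + X = _]big_nat_recr//=.
rewrite subSnn big_nat1 subnn addrA -big_split/=; congr (_ + _).
rewrite !big_nat; apply: eq_bigr => i /= iN.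
by rewrite -mulrDr subSn ?(ltnW iN)// [in RHS]big_nat_recr.
Qed.

(** Geometric domination replaces absolute convergence. The product of the
    partial sums minus the partial sum of the convolution is the sum of the
    [u i * v j] with [i, j < N] and [N <= i + j], of norm at most
    [M * L * N ^ 2 * 8^-N]; the ratio 1/8 is small enough for [N ^ 2 <= 4 ^ N]
    to absorb the number of terms. *)
Lemma cvg_cauchy_product (C : numFieldType) (u v : nat -> C) (M L A B : C) :
  (fun n => 2^-1 ^+ n : C) @ \oo --> (0 : C) ->
  (forall n, `|u n| <= M * 8^-1 ^+ n) -> (forall n, `|v n| <= L * 8^-1 ^+ n) ->
  series u @ \oo --> A -> series v @ \oo --> B ->
  series (fun n => \sum_(0 <= j < n.+1) u j * v (n - j)%N) @ \oo --> A * B.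
Proof.
move=> half0 uM vL uA vB.
have M0 : 0 <= M by have := uM 0%N; rewrite expr0 mulr1; apply: le_trans.
have L0 : 0 <= L by have := vL 0%N; rewrite expr0 mulr1; apply: le_trans.
have e0 : 0 <= 8^-1 :> C by rewrite invr_ge0.
set w := fun n => _.
rewrite (_ : series w = series u * series v - (series u * series v - series w));
  last by rewrite opprB addrC subrK.
rewrite -[A * B]subr0; apply: cvgB; first exact: cvgM uA vB.
apply: (@cvg0_geometric _ _ (M * L) half0) => N.
have -> : (series u * series v - series w) N =
    \sum_(0 <= i < N) u i * \sum_(N - i <= j < N) v j.
  rewrite !fctE series_convE /series/= mulr_suml -sumrB.
  apply: eq_bigr => i _; rewrite -mulrBr; congr (_ * _).
  by rewrite (@big_cat_nat _ _ _ (N - i)%N 0 N)//= ?leq_subr// addrAC subrr add0r.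
apply: le_trans (ler_norm_sum _ _ _) _.
apply: (@le_trans _ _ (\sum_(0 <= i < N) M * L * (N%:R * 8^-1 ^+ N))).
  rewrite !big_nat; apply: ler_sum => i /= iN.
  apply: (@le_trans _ _ ((M * 8^-1 ^+ i) * (L * N%:R * 8^-1 ^+ (N - i)))).
    rewrite normrM ler_pM//.
    apply: le_trans (ler_norm_sum _ _ _) _.
    apply: (@le_trans _ _ (\sum_(N - i <= j < N) L * 8^-1 ^+ (N - i))).
      rewrite !big_nat; apply: ler_sum => j /andP[Nij _].
      apply: le_trans (vL j) _; rewrite ler_wpM2l//.
      by rewrite ler_wiXn2l// invf_le1// ler1n.
    rewrite sumr_const_nat subKn ?(ltnW iN)// -(mulr_natr (L * _)) mulrAC.
    by rewrite ler_wpM2r ?exprn_ge0// ler_wpM2l// ler_nat ltnW.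
  rewrite -[in leRHS](subnKC (ltnW iN)) exprD le_eqVlt; apply/orP; left.
  by apply/eqP; rewrite subnKC ?(ltnW iN)//; ring.
rewrite sumr_const_nat subn0 -(mulr_natr (M * L * _)) -mulrA ler_wpM2l ?mulr_ge0//.
rewrite mulrAC -natrM (_ : 8^-1 = 4^-1 * 2^-1); last by rewrite -invfM -natrM.
rewrite exprMn mulrA ler_piMl ?exprn_ge0 ?invr_ge0//.
rewrite exprVn ler_pdivrMr ?exprn_gt0// mul1r -natrX ler_nat.
by rewrite (_ : 4 = 2 * 2)%N// expnMn leq_mul// ltnW// ltn_expl.
Qed.

(** Exponential coefficients multiply by binomial convolution. *)
Lemma has_egfM (C : numFieldType) (f g : C -> C) (a b : nat -> C) :
  (fun n => 2^-1 ^+ n : C) @ \oo --> (0 : C) ->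
  has_egf f a -> has_egf g b ->
  has_egf (fun t => f t * g t)
    (fun n => \sum_(0 <= j < n.+1) 'C(n, j)%:R * a j * b (n - j)%N).
Proof.
move=> half0 fa gb.
have e0 : 0 < 8^-1 :> C by rewrite invr_gt0.
have [M _ Ma] := @has_egf_terms_le _ _ _ _ e0 fa.
have [L _ Lb] := @has_egf_terms_le _ _ _ _ e0 gb.
near=> t.
have uM : forall n, `|a n * (t ^+ n / n`!%:R)| <= M * 8^-1 ^+ n by near: t.
have vL : forall n, `|b n * (t ^+ n / n`!%:R)| <= L * 8^-1 ^+ n by near: t.
have uA : series (fun n => a n * (t ^+ n / n`!%:R)) @ \oo --> f t by near: t.
have vB : series (fun n => b n * (t ^+ n / n`!%:R)) @ \oo --> g t by near: t.
rewrite [X in series X](_ : _ = fun n => \sum_(0 <= j < n.+1)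
    (a j * (t ^+ j / j`!%:R)) * (b (n - j)%N * (t ^+ (n - j) / (n - j)`!%:R))).
  exact: (@cvg_cauchy_product _ _ _ M L _ _ half0 uM vL uA vB).
apply/funext => n; rewrite mulr_suml !big_nat; apply: eq_bigr => j /=.
rewrite ltnS => jn.
have fN0 k : k`!%:R != 0 :> C by rewrite pnatr_eq0 -lt0n fact_gt0.
have cE : 'C(n, j)%:R = n`!%:R / (j`!%:R * (n - j)`!%:R) :> C.
  by rewrite -(bin_fact jn) !natrM mulfK// mulf_neq0.
rewrite cE -[X in t ^+ X](subnKC jn) exprD.
by field; rewrite !fN0.
Unshelve. all: by end_near. Qed.

(** * The complex exponential series *)

Lemma cvg_real_complex (R : realType) (u : nat -> R) (l : R) :
  u @ \oo --> l ->
  (fun n => (u n)%:C : (R[i] : numFieldType)) @ \oo --> (l%:C : (R[i] : numFieldType)).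
Proof.
move=> ul; apply/cvgrPdist_lt => eps eps0.
have /complex_realP[e epse] := gtr0_real eps0.
have e0 : 0 < e by rewrite -ltcR -epse.
have /cvgrPdist_lt/(_ _ e0) := ul.
apply: filterS => n ln; rewrite -rmorphB epse normc_def/=.
by rewrite expr0n/= addr0 sqrtr_sqr ltcR.
Qed.

Lemma cvg_half_complex (R : realType) :
  (fun n => 2^-1 ^+ n : (R[i] : numFieldType)) @ \oo --> (0 : (R[i] : numFieldType)).
Proof.
have half0 : (fun n => 2^-1 ^+ n : R) @ \oo --> (0 : R).
  by apply: cvg_expr; rewrite ger0_norm ?invr_ge0// invf_lt1// ltr1n.
rewrite (_ : (fun n => _) = fun n => (2^-1 ^+ n : R)%:C).
  exact: cvg_real_complex half0.
by apply/funext => n; rewrite rmorphXn/= fmorphV rmorph_nat.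
Qed.

(** A term of the series of [expR (8 * `|z|)] is at most its sum. *)
Lemma expc_terms_le (R : realType) (z : R[i]) :
  exists M, forall n, `|z ^+ n / n`!%:R| <= M * 8^-1 ^+ n.
Proof.
have /complex_realP[r zr] := normr_real z.
have r0 : 0 <= r by rewrite -lecR -zr; exact: normr_ge0.
have x0 : 0 <= r * 8 by rewrite mulr_ge0.
have term_ge0 n : 0 <= exp_coeff (r * 8) n by rewrite /exp_coeff/= divr_ge0 ?exprn_ge0.
exists (expR (r * 8))%:C => n.
have le_exp : exp_coeff (r * 8) n <= expR (r * 8).
  apply: (@le_trans _ _ (series (exp_coeff (r * 8)) n.+1)).
    by rewrite /series/= big_nat_recr//= lerDr sumr_ge0.
  apply: nondecreasing_cvgn_le; last exact: is_cvg_series_exp_coeff.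
  by apply/nondecreasing_seqP => m; rewrite /series/= big_nat_recr//= lerDl.
rewrite normrM normrX normfV normr_nat zr.
have -> : r%:C ^+ n / n`!%:R = (exp_coeff (r * 8) n)%:C * 8^-1 ^+ n.
  rewrite /exp_coeff/= rmorphM fmorphV rmorphXn rmorphM/= !rmorph_nat exprMn.
  by rewrite exprVn [RHS]mulrAC mulfK// expf_neq0// pnatr_eq0.
by rewrite ler_wpM2r ?exprn_ge0 ?invr_ge0// lecR.
Qed.

(** Euler's formula: the even terms give [cos], the odd ones ['i%C * sin]. *)
Lemma cvg_expi_series (R : realType) (b : R) :
  series (fun n => ('i%C * b%:C) ^+ n / n`!%:R : (R[i] : numFieldType)) @ \oo -->
    (cos b +i* sin b : (R[i] : numFieldType)).
Proof.
rewrite [X in series X](_ : _ = fun n => (cos_coeff b n)%:C +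
  'i%C * (sin_coeff b n)%:C); last first.
  apply/funext => n; rewrite /cos_coeff /sin_coeff/=.
  rewrite !rmorphM !fmorphV !rmorphXn /= !rmorph_nat exprMn.
  have half_odd : odd n -> n.-1./2 = n./2.
    by case: n => //= n; rewrite uphalf_half => /negbTE ->.
  have -> : 'i%C ^+ n = (~~ odd n)%:R * (-1)%:C ^+ n./2 +
      'i%C * ((odd n)%:R * (-1)%:C ^+ n.-1./2) :> R[i].
    rewrite -[in LHS](odd_double_half n) exprD -mul2n exprM sqr_i rmorphN1.
    case: (odd n) half_odd => [->//|_] /=.
      by rewrite expr1 mul0r add0r mul1r.
    by rewrite expr0 !mul1r mul0r mulr0 addr0.
  by ring.
have -> : cos b +i* sin b = (cos b)%:C + 'i%C * (sin b)%:C :> R[i].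
  by apply/eqP; rewrite eq_complex/=; apply/andP; split; apply/eqP; ring.
have cb : series (cos_coeff b) @ \oo --> cos b.
  by rewrite unlock; exact: is_cvg_series_cos_coeff.
have sb : series (sin_coeff b) @ \oo --> sin b.
  by rewrite unlock; exact: is_cvg_series_sin_coeff.
rewrite (_ : series _ = (fun N => (series (cos_coeff b) N)%:C) +
   (fun N => 'i%C * (series (sin_coeff b) N)%:C)).
  apply: cvgD; first exact: cvg_real_complex.
  by apply: cvgMl_tmp; exact: cvg_real_complex.
by apply/funext => N; rewrite fctE /series/= big_split/= -mulr_sumr !rmorph_sum.
Qed.

Lemma cexpD (R : realType) (z w : R[i]) : cexp (z + w) = cexp z * cexp w.
Proof.
case: z w => [a b] [c d]; apply/eqP; rewrite eq_complex/= expRD cosD sinD.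
by apply/andP; split; apply/eqP; ring.
Qed.

Lemma cexp0 (R : realType) : cexp (0 : R[i]) = 1.
Proof. by rewrite /cexp/= expR0 cos0 sin0 mulr1 mulr0. Qed.

Lemma cexp_natM (R : realType) (k : nat) (t : R[i]) : cexp (k%:R * t) = cexp t ^+ k.
Proof.
elim: k => [|k IHk]; first by rewrite mul0r cexp0.
by rewrite -natr1 mulrDl mul1r cexpD IHk exprSr.
Qed.

Lemma cvg_cexp_series (R : realType) (z : R[i]) :
  series (fun n => z ^+ n / n`!%:R : (R[i] : numFieldType)) @ \oo -->
    (cexp z : (R[i] : numFieldType)).
Proof.
case: z => a b.
have -> : cexp (a +i* b) = (expR a)%:C * (cos b +i* sin b).
  by apply/eqP; rewrite eq_complex/=; apply/andP; split; apply/eqP; ring.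
have [M aM] := expc_terms_le _ a%:C.
have [L bL] := expc_terms_le _ ('i%C * b%:C).
have ea : series (fun n => a%:C ^+ n / n`!%:R : (R[i] : numFieldType)) @ \oo -->
    ((expR a)%:C : (R[i] : numFieldType)).
  rewrite (_ : series _ = fun N => (series (exp_coeff a) N)%:C).
    by apply: cvg_real_complex; exact: is_cvg_series_exp_coeff.
  apply/funext => N; rewrite /series/= rmorph_sum; apply: eq_bigr => n _.
  by rewrite /exp_coeff/= rmorphM fmorphV rmorphXn/= rmorph_nat.
have := @cvg_cauchy_product (R[i] : numFieldType) _ _ M L _ _
  (cvg_half_complex R) aM bL ea (cvg_expi_series R b).
rewrite [X in series X](_ : _ = fun n => (a +i* b) ^+ n / n`!%:R)//.
apply/funext => n.
have -> : a +i* b = 'i%C * b%:C + a%:C.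
  by apply/eqP; rewrite eq_complex/=; apply/andP; split; apply/eqP; ring.
rewrite exprDn mulr_suml big_mkord; apply: eq_bigr => -[j /=]; rewrite ltnS => jn _.
have fN0 k : k`!%:R != 0 :> R[i] by rewrite pnatr_eq0 -lt0n fact_gt0.
rewrite -mulr_natr -(bin_fact jn) !natrM.
have : 'C(n, j)%:R != 0 :> R[i] by rewrite pnatr_eq0 -lt0n bin_gt0.
by move=> ?; field; rewrite !fN0.
Qed.

Lemma has_egf_cexp (R : realType) (c : R[i]) :
  has_egf (fun t : R[i] => cexp (c * t)) (fun n => c ^+ n).
Proof.
apply: nearW => t.
rewrite [X in series X](_ : _ = fun n => (c * t) ^+ n / n`!%:R).
  exact: cvg_cexp_series.
by apply/funext => n; rewrite exprMn mulrA.
Qed.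

(** * Linear operations on expansions *)

Lemma has_egfD (C : numFieldType) (f g : C -> C) (a b : nat -> C) :
  has_egf f a -> has_egf g b ->
  has_egf (fun t => f t + g t) (fun n => a n + b n).
Proof.
move=> fa gb; near=> t.
rewrite (_ : series _ = series (fun n => a n * (t ^+ n / n`!%:R)) +
    series (fun n => b n * (t ^+ n / n`!%:R))).
  apply: cvgD; [near: t; exact: fa|near: t; exact: gb].
apply/funext => N; rewrite fctE /series/= -big_split; apply: eq_bigr => i _.
by rewrite mulrDl.
Unshelve. all: by end_near. Qed.

Lemma has_egfZ (C : numFieldType) (f : C -> C) (a : nat -> C) (k : C) :
  has_egf f a -> has_egf (fun t => k * f t) (fun n => k * a n).
Proof.
apply: filterS => t fa.
rewrite (_ : series _ = fun N => k * series (fun n => a n * (t ^+ n / n`!%:R)) N).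
  exact: cvgMl_tmp.
apply/funext => N; rewrite /series/= mulr_sumr; apply: eq_bigr => i _.
by rewrite mulrA.
Qed.

Lemma has_egf_sum (C : numFieldType) (F : nat -> C -> C) (A : nat -> nat -> C) (k : nat) :
  (forall i, has_egf (F i) (A i)) ->
  has_egf (fun t => \sum_(i < k) F i t) (fun n => \sum_(i < k) A i n).
Proof.
move=> FA; elim: k => [|k IHk].
  rewrite (_ : (fun t => _) = fun t => 0 * F 0%N t).
    rewrite (_ : (fun n => _) = fun n => 0 * A 0%N n); first exact: has_egfZ.
    by apply/funext => n; rewrite big_ord0 mul0r.
  by apply/funext => t; rewrite big_ord0 mul0r.
under eq_fun do rewrite big_ord_recr/=.
under [X in has_egf _ X]eq_fun do rewrite big_ord_recr/=.
exact: has_egfD.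
Qed.

(** * Stirling numbers of the second kind *)

(** The explicit formula for the Stirling number of the second kind, as an
    element of [C]. *)
Definition stirling_sum (C : numFieldType) (j k : nat) : C :=
  (\sum_(i < k.+1) (-1) ^+ (k - i) * i%:R ^+ j *+ 'C(k, i)) / k`!%:R.

Lemma stirling_sum0S (C : numFieldType) (k : nat) : stirling_sum C 0 k.+1 = 0.
Proof.
have := exprDn (-1 : C) 1 k.+1; rewrite addNr expr0n/=.
under eq_bigr do rewrite expr1n.
by rewrite /stirling_sum => <-; rewrite mul0r.
Qed.

Lemma stirling_sumS0 (C : numFieldType) (j : nat) : stirling_sum C j.+1 0 = 0.
Proof. by rewrite /stirling_sum big_ord1 expr0n/= mulr0 mul0rn mul0r. Qed.

Lemma stirling_sum00 (C : numFieldType) : stirling_sum C 0 0 = 1.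
Proof. by rewrite /stirling_sum big_ord1 !expr0 mulr1 divr1. Qed.

(** The usual recurrence. After clearing denominators, and adding to the sum
    for [k] the term [i = k.+1], which vanishes, it holds term by term by
    [(k + 1) 'C(k, i) = (k + 1 - i) 'C(k + 1, i)]. *)
Lemma stirling_sumSS (C : numFieldType) (j k : nat) :
  stirling_sum C j.+1 k.+1 =
  k.+1%:R * stirling_sum C j k.+1 + stirling_sum C j k.
Proof.
rewrite /stirling_sum.
have -> : \sum_(i < k.+1) (-1) ^+ (k - i) * (i%:R : C) ^+ j *+ 'C(k, i) =
    \sum_(i < k.+2) (-1) ^+ (k - i) * (i%:R : C) ^+ j *+ 'C(k, i).
  by rewrite [RHS]big_ord_recr/= bin_small// mulr0n addr0.
have fN0 m : m`!%:R != 0 :> C by rewrite pnatr_eq0 -lt0n fact_gt0.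
have kN0 : k.+1%:R != 0 :> C by rewrite pnatr_eq0.
rewrite factS natrM.
apply: (@mulIf _ (k.+1%:R * k`!%:R)); first by rewrite mulf_neq0.
rewrite divfK ?mulf_neq0// mulrDl.
set S1 := (X in _ = _ * (X / _) * _ + _); set S2 := (X in _ = _ + X / _ * _).
have clear_denom (x y s1 s2 : C) : x != 0 -> y != 0 ->
    x * (s1 / (x * y)) * (x * y) + s2 / y * (x * y) = x * s1 + x * s2.
  by move=> x0 y0; field; rewrite ?x0 ?y0.
rewrite clear_denom//.
rewrite -mulrDr -big_split mulr_sumr/=; apply: eq_bigr => -[i /=]; rewrite ltnS => ik _.
have binE : k.+1%:R * 'C(k, i)%:R = (k.+1%:R - i%:R) * 'C(k.+1, i)%:R :> C.
  by rewrite -natrB// -!natrM mul_bin_down.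
rewrite -!(mulr_natr (_ * _)) mulrDr.
move: ik; rewrite leq_eqVlt => /predU1P[->|].
  by rewrite (@bin_small k k.+1)// mulr0n !mulr0 addr0 exprS; ring.
rewrite ltnS => ik; rewrite subSn// !exprS.
rewrite [X in _ = _ + X](_ : _ =
  (-1) ^+ (k - i) * i%:R ^+ j * (k.+1%:R * 'C(k, i)%:R)); last by ring.
by rewrite binE; ring.
Qed.

Lemma stirling_sum_small (C : numFieldType) (j k : nat) :
  (j < k)%N -> stirling_sum C j k = 0.
Proof.
elim: j k => [|j IHj] [|k]// jk; first exact: stirling_sum0S.
by rewrite stirling_sumSS !IHj ?mulr0 ?addr0// ltnW.
Qed.

Lemma fallingS (C : numFieldType) (x : C) (k : nat) :
  falling x k.+1 = falling x k * (x - k%:R).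
Proof. by rewrite /falling big_ord_recr. Qed.

Lemma sum_falling_stirling (C : numFieldType) (x : C) (j K : nat) :
  (j < K)%N -> \sum_(0 <= k < K) falling x k * stirling_sum C j k = x ^+ j.
Proof.
elim: j K => [|j IHj] [|K]// jK.
  rewrite big_nat_recl//= big1 ?addr0 => [|i _]; last by rewrite stirling_sum0S mulr0.
  by rewrite stirling_sum00 mulr1 /falling big_ord0.
rewrite big_nat_recl//= stirling_sumS0 mulr0 add0r exprS -(IHj K)// mulr_sumr.
(* By [x * falling x k = falling x k.+1 + k * falling x k] and the recurrence,
   the two sides differ by a telescoping sum of [h]. *)
pose h k := falling x k * k%:R * stirling_sum C j k.
have telK : \sum_(0 <= k < K) (h k.+1 - h k) = 0.
  by rewrite telescope_sumr// /h stirling_sum_small// !mulr0 mul0r subr0.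
rewrite -[RHS]addr0 -[X in _ = _ + X]telK -big_split/=; apply: eq_bigr => k _.
by rewrite /h stirling_sumSS fallingS; ring.
Qed.

(** The binomial theorem writes [(e^t - 1)^k / k!] as a linear combination of
    the functions [e^(i t)], and [e^(i t)] has exponential coefficients
    [i ^ n]. *)
Lemma stirling2E (R : realType) (j k : nat) : stirling2 R j k = stirling_sum R[i] j k.
Proof.
suff egfS : has_egf (fun t : R[i] => (cexp t - 1) ^+ k / k`!%:R)
    (fun m => stirling_sum R[i] m k) by rewrite /stirling2 (egf_coefE _ _ _ egfS).
pose A i n : R[i] := (-1) ^+ (k - i) * 'C(k, i)%:R * i%:R ^+ n.
pose F i t : R[i] := (-1) ^+ (k - i) * 'C(k, i)%:R * cexp (i%:R * t).
have FA i : has_egf (F i) (A i) by apply: has_egfZ; exact: has_egf_cexp.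
rewrite (_ : (fun t => _) = fun t => k`!%:R^-1 * \sum_(i < k.+1) F i t); last first.
  apply/funext => t; rewrite mulrC [cexp t - 1]addrC exprDn; congr (_ * _).
  by apply: eq_bigr => i _; rewrite /F cexp_natM -mulr_natr mulrAC.
rewrite (_ : (fun m => _) = fun m => k`!%:R^-1 * \sum_(i < k.+1) A i m).
  by apply: has_egfZ; exact: has_egf_sum.
apply/funext => m; rewrite /stirling_sum mulrC; congr (_ * _).
by apply: eq_bigr => i _; rewrite /A -mulr_natr mulrAC.
Qed.

(** * The expansion of the Bell based Apostol type polynomials *)

Theorem theorem3p4 (R : realType) (alpha : nat) (lambda eta delta : R[i])
    (hadm : admissible alpha lambda delta) (n : nat) (hn : (1 <= n)%N)
    (x1 x2 : R[i]) :
  bell_apostol alpha x1 x2 lambda eta delta n =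
  \sum_(0 <= j < n.+1) \sum_(k \in [set: nat])
    'C(n, j)%:R * falling x1 k * stirling2 R j k
      * bell_apostol1 alpha x2 lambda eta delta (n - j).
Proof.
pose g (t : R[i]) := apostol_factor alpha lambda eta delta t
                     * cexp (0 * t + x2 * (cexp t - 1)).
have fE : (fun t : R[i] => apostol_factor alpha lambda eta delta t
    * cexp (x1 * t + x2 * (cexp t - 1))) = fun t => cexp (x1 * t) * g t.
  by apply/funext => t; rewrite /g mul0r add0r cexpD mulrCA.
have gE : g = fun t => cexp (- x1 * t) * (cexp (x1 * t) * g t).
  by apply/funext => t; rewrite mulrA -cexpD mulNr addNr cexp0 mul1r.
rewrite /bell_apostol1 /bell_apostol fE -/g.
(* Without an expansion, [egf_coef] is 0 by convention. *)
have [[b gb]|nog] := pselect (exists b, has_egf g b); last first.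
  have nof a : ~ has_egf (fun t => cexp (x1 * t) * g t) a.
    move=> fa; apply: nog; rewrite gE; eexists.
    exact: (@has_egfM _ _ _ _ _ (cvg_half_complex R) (has_egf_cexp R (- x1)) fa).
  have -> : egf_coef g = fun=> 0.
    by apply: egf_coef_eq0 => b gb; apply: nog; exists b.
  rewrite (egf_coef_eq0 _ _ nof) big1// => j _.
  by rewrite fsbig1// => k _; rewrite mulr0.
rewrite (egf_coefE _ _ _ gb).
rewrite (egf_coefE _ _ _ (@has_egfM _ _ _ _ _ (cvg_half_complex R) (has_egf_cexp R x1) gb)).
apply: eq_bigr => j _.
rewrite (fsbigE (index_iota 0 j.+1)) ?iota_uniq//; last first.
  move=> k _; rewrite mem_index_iota ltnS -ltnNge => jk.
  by rewrite stirling2E stirling_sum_small// mulr0 mul0r.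
rewrite (eq_bigl xpredT) => [|k]; last by rewrite in_setT.
rewrite -(sum_falling_stirling _ x1 _ _ (ltnSn j)) mulr_sumr mulr_suml.
by apply: eq_bigr => k _; rewrite stirling2E mulrA.
Qed.
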